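(* Let $w$ be an infinite recurrent binary word generated by a morphism $\phi$. If $\det A_\phi=\pm1$, then $w$ satisfies the WELLDOC property.
   Context: Alphabet $\Sigma=\{0,1\}$; a binary word by convention contains both letters. A morphism is nonerasing; $w$ is generated by $\phi$ if $\phi(a)=as$ with $s$ nonempty and $w=\lim_n\phi^n(a)$. $A_\phi$ is the $2\times2$ matrix with entry $|\phi(i)|_j$ in row $j$, column $i$. Parikh vector $V_u=(|u|_0,|u|_1)$. For a factor $u$ of $w$ occurring at positions $a_0<a_1<\dots$, $X_u=\{V_{w[0,a_i)}\}$, $X_{u,m}$ its reduction mod $m$; WELLDOC means $X_{u,m}=(\mathbb{Z}/m\mathbb{Z})^2$ for all $m\ge1$ and all factors $u$. Recurrent: every factor occurs infinitely often. *)

(* Defs.v *)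
From mathcomp Require Import all_boot all_order all_algebra.
From mathcomp Require Import classical_sets.
Set Implicit Arguments.
Unset Strict Implicit.
Unset Printing Implicit Defensive.
Import GRing.Theory.

(* The letters 0 and 1 are [ord0] and [ord_max]. *)
Notation letter := 'I_2.
Definition word := nat -> letter.

Definition binary (w : word) : Prop := forall a : letter, exists i, w i = a.

(* [subword w i n] is w[i, i + n). *)
Definition subword (w : word) (i n : nat) : seq letter :=
  mkseq (fun k => w (i + k)) n.

Definition occurs_at (w : word) (u : seq letter) (i : nat) : Prop :=
  subword w i (size u) = u.

Definition factor (w : word) (u : seq letter) : Prop :=
  exists i, occurs_at w u i.

Definition recurrent (w : word) : Prop :=
  forall u, factor w u -> forall n, exists2 i, n <= i & occurs_at w u i.

Definition nonerasing_morphism (phi : seq letter -> seq letter) : Prop :=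
  {morph phi : u v / u ++ v} /\ forall a : letter, phi [:: a] <> [::].

(* Convergence of finite words to an infinite word: every prefix of [w] is
   eventually a prefix of the terms of the sequence. *)
Definition word_limit (s : nat -> seq letter) (w : word) : Prop :=
  forall k, exists N, forall n, N <= n -> prefix (subword w 0 k) (s n).

Definition generated_by (w : word) (phi : seq letter -> seq letter) : Prop :=
  exists (a : letter) (s : seq letter),
    [/\ phi [:: a] = a :: s, s <> [::] &
        word_limit (fun n => iter n phi [:: a]) w].

Definition incidence_mx (phi : seq letter -> seq letter) : 'M[int]_2 :=
  (\matrix_(j < 2, i < 2) (count_mem j (phi [:: i]))%:Z)%R.

Definition Parikh (u : seq letter) : nat * nat :=
  (count_mem ord0 u, count_mem ord_max u).

Local Open Scope classical_set_scope.

Definition occ_Parikh (w : word) (u : seq letter) : set (nat * nat) :=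
  [set Parikh (subword w 0 i) | i in [set i | occurs_at w u i]].

(* Reduction mod [m], with Z/mZ represented by ['I_m] since ['Z_1] is Z/2Z. *)
Definition occ_Parikh_mod (w : word) (u : seq letter) (m : nat) :
    set ('I_m * 'I_m) :=
  [set r : 'I_m * 'I_m | exists2 v, occ_Parikh w u v &
     r.1 = v.1 %[mod m] /\ r.2 = v.2 %[mod m]].

Arguments occ_Parikh_mod w u m _ : clear implicits.

Definition WELLDOC (w : word) : Prop :=
  forall (m : nat) (u : seq letter), 0 < m -> factor w u ->
    occ_Parikh_mod w u m = [set: 'I_m * 'I_m].

(* Main.v *)
(* Fix m >= 2 and let S and T be the sets of Parikh vectors mod m of the
   prefixes of w that precede an occurrence of a, resp. of the other letter b.
   Some power psi of phi has incidence matrix 1 mod m, and psi can be taken so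
   long that a given occurrence of u at p lies inside psi(a): applying psi to w
   at an occurrence of a shows S + P_p <= X_u.  With u = a, the finite set S is
   closed under addition, hence a subgroup, and it remains to prove S full.
   Since phi(b) contains a (else a occurs only once in w), some translate of T
   lies in S, so T - T <= S.  The factors ab and ba then give e_a + e_b in S,
   and a factor aa or bb gives e_a or e_b in S.  If neither aa nor bb occurs,
   w = (ab)^omega, so A_phi (1,1) = k (1,1) with k >= 2 dividing det A_phi. *)
Require Import Defs.
From mathcomp Require Import all_boot all_order all_algebra.
From mathcomp Require Import classical_sets.
From mathcomp Require Import fingroup.
From mathcomp Require Import zify.

Set Implicit Arguments.
Unset Strict Implicit.
Unset Printing Implicit Defensive.
Import GRing.Theory.

(** * Subwords and occurrences *)

Lemma subwordD w i m n :
  subword w i (m + n) = subword w i m ++ subword w (i + m) n.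
Proof.
rewrite /subword /mkseq iotaD map_cat add0n -[in iota m n](addn0 m) iotaDl.
by rewrite -map_comp; congr (_ ++ _); apply: eq_map => k /=; rewrite addnA.
Qed.

Lemma size_subword w i n : size (subword w i n) = n.
Proof. exact: size_mkseq. Qed.

Lemma subword1 w i : subword w i 1 = [:: w i].
Proof. by rewrite /subword /mkseq /= addn0. Qed.

Lemma subword0S w n : subword w 0 n.+1 = rcons (subword w 0 n) (w n).
Proof. exact: mkseqS. Qed.

Lemma occurs_at1 w c i : occurs_at w [:: c] i <-> w i = c.
Proof. by rewrite /occurs_at subword1; split=> [[]|->]. Qed.

Lemma occurs_at_cat w u v i :
  occurs_at w (u ++ v) i <-> occurs_at w u i /\ occurs_at w v (i + size u).
Proof.
rewrite /occurs_at size_cat subwordD; split=> [/eqP|[-> ->] //].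
by rewrite eqseq_cat ?size_subword // => /andP[/eqP ? /eqP ?].
Qed.

(** * The two-letter alphabet and Parikh vectors over a ring *)

Lemma letter_cases (a b c : letter) : b != a -> c = a \/ c = b.
Proof.
move=> neq; case: (eqVneq c a) => [|nca]; first by left.
right; apply: val_inj; move: neq nca (ltn_ord a) (ltn_ord b) (ltn_ord c).
by rewrite -!val_eqE /=; lia.
Qed.

Lemma sum_letter (R : nmodType) (a b : letter) (F : letter -> R) :
  b != a -> (\sum_c F c = F a + F b)%R.
Proof.
move=> neq; rewrite (bigD1 a) //= (bigD1 b) //= big1 ?addr0 // => c.
by case: (letter_cases c neq) => ->; rewrite eqxx ?andbF.
Qed.

(** Exchanging the two letters leaves the formula unchanged, so the starting letter [a] may be
    either 0 or 1. *)
Lemma det_letter (R : comNzRingType) (a b : letter) (M : 'M[R]_2) :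
  b != a -> (\det M = M a a * M b b - M a b * M b a)%R.
Proof.
have det2 : (\det M = M ord0 ord0 * M ord_max ord_max
                    - M ord0 ord_max * M ord_max ord0)%R.
  rewrite (expand_det_row _ ord0) (@sum_letter _ ord0 ord_max) //.
  rewrite /cofactor !det_mx11 !mxE /=.
  have -> : lift ord0 0%R = ord_max :> letter by apply: val_inj.
  have -> : lift ord_max 0%R = ord0 :> letter by apply: val_inj.
  by rewrite expr0 expr1 mul1r mulN1r mulrN.
have [->|->] := @letter_cases ord0 ord_max a isT;
have [->|->] := @letter_cases ord0 ord_max b isT => // _; rewrite det2.
by rewrite mulrC [in X in (_ - X)%R]mulrC.
Qed.

Section Parikh_vector.
Variable R : pzRingType.
Local Open Scope ring_scope.

Definition parikh (u : seq letter) : 'cV[R]_2 := \col_j (count_mem j u)%:R.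

Lemma parikh_cat u v : parikh (u ++ v) = parikh u + parikh v.
Proof. by apply/matrixP => j k; rewrite !mxE count_cat natrD. Qed.

Lemma parikh_nil : parikh [::] = 0.
Proof. by apply/matrixP => j k; rewrite !mxE. Qed.

Definition incidence phi : 'M[R]_2 := map_mx intr (incidence_mx phi).

End Parikh_vector.

Lemma col_ZpE m (a b : letter) (v : 'cV['I_m.+2]_2) : b != a ->
  (v = parikh _ [:: a] *+ v a 0 + parikh _ [:: b] *+ v b 0)%R.
Proof.
move=> nba; have nab : a != b by rewrite eq_sym.
apply/matrixP => j k; rewrite (ord1 k) !(mxE, mulmxnE) /= !addn0.
by have [->|->] := letter_cases j nba;
  rewrite !eqxx ?(negPf nba) ?(negPf nab) mul0rn ?add0r ?addr0 natr_Zp.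
Qed.

(** * Iterates of a morphism and their action on Parikh vectors *)

Section Morphism.
Variable phi : seq letter -> seq letter.
Hypothesis phi_morphism : nonerasing_morphism phi.

Lemma morphism_cat u v : phi (u ++ v) = phi u ++ phi v.
Proof. exact: phi_morphism.1. Qed.

Lemma morphism_nil : phi [::] = [::].
Proof.
by apply/size0nil; have := congr1 size (morphism_cat [::] [::]);
  rewrite size_cat /=; lia.
Qed.

Lemma iter_morphism_cat n u v : iter n phi (u ++ v) = iter n phi u ++ iter n phi v.
Proof. by elim: n => //= n ->; rewrite morphism_cat. Qed.

Lemma size_morphism u : size u <= size (phi u).
Proof.
elim: u => // c u IHu; rewrite -cat1s morphism_cat !size_cat /=.
by have := phi_morphism.2 c; case: (phi [:: c]) => //= *; lia.
Qed.

Lemma size_iter_morphism n u : size u <= size (iter n phi u).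
Proof. by elim: n => //= n IHn; apply: (leq_trans IHn); apply: size_morphism. Qed.

Lemma parikh_morphism (R : pzRingType) u :
  (parikh R (phi u) = incidence R phi *m parikh R u)%R.
Proof.
elim: u => [|c u IHu]; first by rewrite morphism_nil parikh_nil mulmx0.
rewrite -cat1s morphism_cat !parikh_cat mulmxDr IHu; congr (_ + _)%R.
apply/matrixP => j k; rewrite !mxE (bigD1 c) //= big1 ?addr0 => [|d ndc].
  by rewrite !mxE /= eqxx mulr1 -pmulrn.
by rewrite !mxE /= eq_sym (negPf ndc) mulr0.
Qed.

Lemma parikh_iter_morphism (R : pzRingType) n u :
  (parikh R (iter n phi u) = incidence R phi ^+ n *m parikh R u)%R.
Proof.
by elim: n => [|n IHn] /=; rewrite ?expr0 ?mul1mx // parikh_morphism IHn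
  exprS mulmxA.
Qed.

End Morphism.

(** * The structure of the generated word *)

Section Generated_word.
Variables (w : word) (phi : seq letter -> seq letter) (a b : letter) (s : seq letter).
Hypotheses (w_recurrent : recurrent w) (phi_morphism : nonerasing_morphism phi).
Hypotheses (phi_a : phi [:: a] = a :: s) (s_neq0 : s <> [::]).
Hypothesis phi_limit : word_limit (fun n => iter n phi [:: a]) w.
Hypotheses (nba : b != a) (w_b : exists i, w i = b).
Hypothesis det_phi :
  (\det (incidence_mx phi) = 1 \/ \det (incidence_mx phi) = -1)%R.

Lemma iter_letterS n : iter n.+1 phi [:: a] = iter n phi [:: a] ++ iter n phi s.
Proof. by rewrite iterSr phi_a -cat1s iter_morphism_cat. Qed.

Lemma size_iter_letter n : n < size (iter n phi [:: a]).
Proof.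
elim: n => // n IHn; rewrite iter_letterS size_cat.
have s_gt0 : 0 < size s by case: (s) s_neq0.
by have := size_iter_morphism phi_morphism n s; lia.
Qed.

Lemma prefix_iter_letter n : occurs_at w (iter n phi [:: a]) 0.
Proof.
have [N hN] := phi_limit (size (iter n phi [:: a])).
(* The limit only speaks of late iterates, but the iterates of [phi] on [a] are nested prefixes of
   one another. *)
have [v Nv] : exists v, iter (N + n) phi [:: a] = iter n phi [:: a] ++ v.
  elim: {hN} N => [|N [v IHN]]; first by exists [::]; rewrite cats0.
  by exists (v ++ iter (N + n) phi s); rewrite addSn iter_letterS IHN catA.
have := hN _ (leq_addr n N); rewrite Nv prefixE size_subword.
by rewrite take_size_cat // => /eqP.
Qed.

Lemma w0 : w 0 = a.
Proof. exact/occurs_at1/(prefix_iter_letter 0). Qed.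

(** The prefix of length [i] is a prefix of the [i]-th iterate on [a], so its image under the [n]-th
    is a prefix of the [(n + i)]-th. *)
Lemma prefix_image n i : occurs_at w (iter n phi (subword w 0 i)) 0.
Proof.
have := prefix_iter_letter (n + i); rewrite iterD -[X in iter n _ X]prefix_iter_letter.
rewrite -(subnKC (ltnW (size_iter_letter i))) subwordD iter_morphism_cat //.
by case/occurs_at_cat.
Qed.

Lemma occurs_at_image n i :
  occurs_at w (iter n phi [:: w i]) (size (iter n phi (subword w 0 i))).
Proof.
have := prefix_image n i.+1; rewrite subword0S -cats1 iter_morphism_cat //.
by case/occurs_at_cat.
Qed.

Lemma det_count :
  let N c d : int := (count_mem c (phi [:: d]))%:Z%R in
  (N a a * N b b - N a b * N b a = 1 \/ N a a * N b b - N a b * N b a = -1)%R.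
Proof. by move=> N; move: det_phi; rewrite (det_letter _ nba) !mxE. Qed.

(** If [phi [:: b]] had no [a], the determinant would force exactly one [a] in [phi [:: a]]. Then
    [phi] preserves the number of [a]'s, and every iterate on [a] contains just one, against
    recurrence. *)
Lemma letter_in_image : a \in phi [:: b].
Proof.
rewrite -has_pred1 has_count lt0n; apply/negP => /eqP ab0.
have aa1 : count_mem a (phi [:: a]) = 1.
  have := det_count; rewrite /= ab0 mul0r subr0 -PoszM.
  by case=> // -[/eqP]; rewrite muln_eq1 => /andP[/eqP].
have count_a n u : count_mem a (iter n phi u) = count_mem a u.
  elim: n => //= n <-; elim: (iter n phi u) => [|c v IHv].
    by rewrite morphism_nil.
  rewrite -cat1s morphism_cat // !count_cat IHv; congr (_ + _)%N.
  by have [->|->] := letter_cases c nba; rewrite ?aa1 ?ab0 /= ?eqxx ?(negPf nba).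
have [|[//|i] _ /occurs_at1 wi] := w_recurrent (u := [:: a]) _ 1.
  by exists 0; apply/occurs_at1/w0.
(* This iterate has more than [i.+1] letters, hence contains the two [a]'s at positions 0 and
   [i > 0]. *)
have := count_a i.+1 [:: a]; rewrite -[X in count_mem _ X]prefix_iter_letter.
rewrite -(subnKC (size_iter_letter i.+1)) subwordD count_cat subword0S -cats1.
rewrite count_cat -[in subword _ _ _]add1n subwordD count_cat subword1 w0 /=.
by rewrite wi eqxx; lia.
Qed.

Lemma square_letter : exists i, w i = w i.+1.
Proof.
apply: boolp.contrapT => no_square.
have nsq i : w i != w i.+1 by apply/eqP => e; apply: no_square; exists i.
have wE i : w i = if odd i then b else a.
  elim: i => [|i IHi] /=; first exact: w0.
  have := nsq i; rewrite IHi; have := letter_cases (w i.+1) nba.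
  by case: (odd i) => /= -[->|->]; rewrite ?eqxx.
have count_even c k : count_mem c (subword w 0 k.*2) = k.
  elim: k => // k IHk; rewrite doubleS 2!subword0S -!cats1 !count_cat IHk /=.
  rewrite !wE /= odd_double /=; have nab : a != b by rewrite eq_sym.
  by have [->|->] := letter_cases c nba; rewrite !eqxx ?(negPf nba) ?(negPf nab); lia.
have w2 : subword w 0 2 = [:: a] ++ [:: b] by rewrite /subword /mkseq /= !wE.
(* The image of [w 2 = a] starts with [a] right after the prefix [phi(ab)], so the length [L] of
   that prefix is even and it holds [L./2] copies of each letter. *)
have := prefix_image 1 2; have := occurs_at_image 1 2.
rewrite /= {1}wE /= phi_a -cat1s => /occurs_at_cat[/occurs_at1].
rewrite /occurs_at; set L := size _; rewrite wE.
case: ifP => [_ /eqP|oddL _ _ imageE]; first by rewrite (negPf nba).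
have LE : L = L./2.*2 by rewrite -[LHS]odd_double_half oddL.
have count_image c : count_mem c (phi [:: a]) + count_mem c (phi [:: b]) = L./2.
  by rewrite -count_cat -morphism_cat // -w2 -imageE -[RHS](count_even c) -LE.
have L_ge3 : 2 < L.
  rewrite /L w2 morphism_cat // size_cat phi_a /=.
  have := size_morphism phi_morphism [:: b] => /=.
  by case: (s) s_neq0 => //= *; lia.
have := det_count; move: (count_image a) (count_image b) => /=.
set p := count _ _; set q := count _ _; set r := count _ _; set t := count _ _.
move=> pq rt.
(* Eliminating [p] and [r] shows that [L./2], which is at least 2, divides the determinant. *)
have -> : (p%:Z * t%:Z - q%:Z * r%:Z = L./2%:Z * (t%:Z - q%:Z))%R by nia.
move=> unit_det; have : absz (L./2%:Z * (t%:Z - q%:Z))%R = 1 by case: unit_det => ->.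
by move/eqP; rewrite abszM muln_eq1 => /andP[/eqP /= half1 _]; lia.
Qed.

(** * Residues of prefixes modulo [m.+2] *)

Definition residue m i : 'cV['I_m.+2]_2 := parikh _ (subword w 0 i).

(** The determinant is a unit, so the matrix lies in the finite group of invertible matrices mod
    [m.+2]; its order there serves as exponent. *)
Lemma incidence_expr1 m : exists2 n, 0 < n & (incidence 'I_m.+2 phi ^+ n = 1)%R.
Proof.
have Mu : incidence 'I_m.+2 phi \is a GRing.unit.
  rewrite -[_ \is a _]/(_ \in unitmx) unitmxE det_map_mx.
  by case: det_phi => ->; rewrite ?rmorphN rmorph1 ?unitrN unitr1.
pose g : {unit 'M['I_m.+2]_2} := FinRing.unit _ Mu.
exists #[g]%g; first exact: order_gt0.
by have := congr1 val (expg_order g); rewrite FinRing.val_unitX.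
Qed.

(** The image of the prefix before position [i] is again a prefix of [w], with the same residue; [x]
    lies between it and the new occurrence of [u]. *)
Lemma occurrence_transport m n i x u y :
  (incidence 'I_m.+2 phi ^+ n = 1)%R -> iter n phi [:: w i] = x ++ u ++ y ->
  exists2 j, occurs_at w u j & (residue m j = residue m i + parikh _ x)%R.
Proof.
move=> Mn1 imE; have := occurs_at_image n i.
rewrite imE catA => /occurs_at_cat[/occurs_at_cat[xi ui] _].
eexists; first exact: ui.
rewrite /residue subwordD parikh_cat xi prefix_image.
by rewrite parikh_iter_morphism // Mn1 mul1mx.
Qed.

Lemma occurrence_translate m u p i : occurs_at w u p -> w i = a ->
  exists2 j, occurs_at w u j & (residue m j = residue m i + residue m p)%R.
Proof.
move=> up wi; have [o o_gt0 Mo1] := incidence_expr1 m.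
(* A multiple of the order [o], large enough that the [n]-th iterate on [a] covers the occurrence of
   [u] at [p]. *)
pose n := (o * (p + size u))%N.
have le_n : p + size u <= size (iter n phi [:: a]).
  by apply: leq_trans (ltnW (size_iter_letter n)); apply: leq_pmull.
apply: (@occurrence_transport m n _ _ _
  (subword w (p + size u) (size (iter n phi [:: a]) - (p + size u)))).
  by rewrite exprM Mo1 expr1n.
by rewrite wi -[LHS]prefix_iter_letter -(subnKC le_n) !subwordD -catA up subnKC.
Qed.

Definition letter_residue m (c : letter) (g : 'cV['I_m.+2]_2) :=
  exists2 i, w i = c & residue m i = g.

(** * The subgroup of residues at occurrences of [a] *)

Section Modulus.
Variable m : nat.
Local Open Scope ring_scope.
Local Notation S := (@letter_residue m a).
Local Notation T := (@letter_residue m b).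

Lemma letter_residue0 : S 0.
Proof. by exists 0%N; [exact: w0 | rewrite /residue parikh_nil]. Qed.

Lemma letter_residueD g h : S g -> S h -> S (g + h).
Proof.
move=> [i wi <-] [p wp <-].
have [|j /occurs_at1 wj <-] := @occurrence_translate m [:: a] p i _ wi.
  exact/occurs_at1.
by exists j.
Qed.

Lemma letter_residueMn g n : S g -> S (g *+ n).
Proof.
move=> Sg; elim: n => [|n IHn]; first exact: letter_residue0.
by rewrite mulrS; apply: letter_residueD.
Qed.

Lemma letter_residueN g : S g -> S (- g).
Proof.
(* As [m.+2] annihilates the group, negation is a natural multiple. *)
move=> Sg; have <- : g *+ m.+1 = - g; last exact: letter_residueMn.
apply/esym/addr0_eq; rewrite -mulrS; apply/matrixP => j k.
by rewrite mulmxnE mxE -mulr_natr (@pchar_Zp m.+2) ?mulr0.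
Qed.

Lemma letter_residueB g h : S g -> S h -> S (g - h).
Proof. by move=> Sg /letter_residueN; apply: letter_residueD. Qed.

Lemma letter_residue_diff g h : T g -> T h -> S (g - h).
Proof.
have [[//|n] _ Mn1] := incidence_expr1 m.
(* A positive exponent is essential: one application of [phi] to [b] yields an [a], and the
   remaining ones send it to a word starting with [a]. *)
have [x [y xy]] : exists x y, iter n.+1 phi [:: b] = x ++ [:: a] ++ y.
  rewrite iterSr; have /splitPr[x1 x2] := letter_in_image.
  have [v] : exists v, iter n phi [:: a] = a :: v.
    have := prefix_iter_letter n; have := size_iter_letter n.
    case: (iter n phi _) => // c v _.
    by rewrite -cat1s => /occurs_at_cat[/occurs_at1]; rewrite w0 => <-; exists v.
  rewrite -[a :: x2]cat1s !iter_morphism_cat // => ->.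
  by exists (iter n phi x1), (v ++ iter n phi x2).
have shift k : T k -> S (k + parikh _ x).
  move=> [i wi <-].
  have [|j /occurs_at1 wj <-] := @occurrence_transport m n.+1 i x [:: a] y Mn1.
    by rewrite wi.
  by exists j.
by move=> /shift Sg /shift Sh; have := letter_residueB Sg Sh;
  rewrite opprD addrACA subrr addr0.
Qed.

Lemma residueS i : residue m i.+1 = residue m i + parikh _ [:: w i].
Proof. by rewrite /residue subword0S -cats1 parikh_cat. Qed.

Lemma letter_residue_full g : S g.
Proof.
pose ea := parikh 'I_m.+2 [:: a]; pose eb := parikh 'I_m.+2 [:: b].
have residue_a i : w i = a -> S (residue m i) by exists i.
have residue_b i : w i = b -> T (residue m i) by exists i.
have [j wj wj1] : exists2 j, w j = a & w j.+1 = b.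
  have [k] := w_b; elim: k => [|k IHk] wk.
    by move: nba; rewrite -wk w0 eqxx.
  by have [wka|/IHk //] := letter_cases (w k) nba; exists k.
(* Recurrence gives an [a] beyond the [b] at [j.+1]; walking back from it reaches a factor [ba]. *)
have [k wk wk1] : exists2 k, w k = b & w k.+1 = a.
  have [|n] := w_recurrent (u := [:: a]) _ j.+1.
    by exists 0%N; apply/occurs_at1/w0.
  elim: n => // n IHn; rewrite leq_eqVlt => /orP[/eqP [<-]|jn].
    by move/occurs_at1; rewrite wj1 => ba; move: nba; rewrite ba eqxx.
  move=> /occurs_at1 wn1; have [wna|wnb] := letter_cases (w n) nba.
    by apply: IHn => //; apply/occurs_at1.
  by exists n.
(* With r the residue, this is (r_j + e_a - r_k) + (r_k + e_b) - r_j: a difference from T, plus and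
   minus elements of S. *)
have Sab : S (ea + eb).
  have Tj := residue_b _ wj1; have Tk := residue_b _ wk.
  have := residue_a _ wk1; rewrite residueS wk.
  move/(letter_residueD (letter_residue_diff Tj Tk)); rewrite residueS wj.
  move/letter_residueB/(_ (residue_a _ wj)).
  by congr S; rewrite addrA subrK -(addrA (residue m j)) addrAC subrr add0r.
have Sa_or_b : S ea \/ S eb.
  have [i wii] := square_letter; have [wi|wi] := letter_cases (w i) nba.
    left; have := letter_residueB (residue_a i.+1 _) (residue_a _ wi).
    by rewrite residueS wi addrC addKr -wii; apply.
  right; have := letter_residue_diff (residue_b i.+1 _) (residue_b _ wi).
  by rewrite residueS wi addrC addKr -wii; apply.
have [Sa Sb] : S ea /\ S eb.
  case: Sa_or_b => Se; split=> //; have := letter_residueB Sab Se.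
    by rewrite addrC addKr.
  by rewrite addrK.
by rewrite (col_ZpE g nba); apply: letter_residueD; apply: letter_residueMn.
Qed.

Lemma occurrence_residue u g : factor w u ->
  exists2 i, occurs_at w u i & residue m i = g.
Proof.
move=> [p up]; have [i wi riE] := letter_residue_full (g - residue m p).
have [j uj rj] := occurrence_translate m up wi.
by exists j; rewrite // rj riE subrK.
Qed.

End Modulus.
End Generated_word.

(** * From residues to [WELLDOC] *)

Theorem theorem4 (w : word) (phi : seq letter -> seq letter)
    (w_binary : binary w)
    (w_recurrent : recurrent w)
    (phi_morphism : nonerasing_morphism phi)
    (w_generated : generated_by w phi)
    (det_phi : (\det (incidence_mx phi) = 1 \/ \det (incidence_mx phi) = -1)%R) :
  WELLDOC w.
Proof.
have [a [s [phi_a s_neq0 phi_limit]]] := w_generated.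
have [b nba] : exists b, b != a.
  by have [->|->] := @letter_cases ord0 ord_max a isT; [exists ord_max | exists ord0].
(* Modulus 1 is settled by any occurrence; from 2 on, ['I_m.+2] is the ring of integers mod
   [m.+2]. *)
move=> [//|[|m]] u _ uw; apply/seteqP; split=> // r _.
  have [i ui] := uw; exists (Parikh (subword w 0 i)); first by exists i.
  by rewrite !modn1.
have [i ui ri] := occurrence_residue w_recurrent phi_morphism phi_a s_neq0
  phi_limit nba (w_binary b) det_phi
  (\col_j if j == ord0 then r.1 else r.2)%R uw.
exists (Parikh (subword w 0 i)); first by exists i.
have modE (x : 'I_m.+2) n : (n%:R = x)%R -> x = n %[mod m.+2].
  by move=> <-; rewrite Zp_nat /= modn_mod.
by split; apply: modE; have /matrixP e := ri;
  [have := e ord0 0%R | have := e ord_max 0%R]; rewrite !mxE.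
Qed.
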